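(* Let $X,X'$ be locally projective geometries, each of which is not a reducible projective space and is either of dimension $\geq 4$, or of dimension $3$ and fulfilling the bundle theorem. Let $X\hookrightarrow\mathbb{P}(V)$ and $X'\hookrightarrow\mathbb{P}(V')$ be the respective minimal projective embeddings, where $V$ and $V'$ are vector spaces over division rings $K$ and $K'$ respectively. Any morphism of geometries $\varphi\colon X\to X'$ whose image is not contained in a plane is the restriction of a unique partial projective morphism $\mathbb{P}(V)\dashrightarrow\mathbb{P}(V')$ (that is, there is a unique partial projective morphism $\mathbb{P}(V)\dashrightarrow\mathbb{P}(V')$ which is defined at every point of $X$ and coincides with $\varphi$ on $X$).
   Context: A geometry is a set $X$ (of points) with a family of subsets, called subspaces, such that: (G1) $\emptyset$, $X$ and every singleton $\{x\}$ are subspaces ($\{x\}$ is written $x$); (G2) any intersection of subspaces is a subspace; (G3) for a subspace $S$ and a point $x\notin S$ there is no subspace $S'$ with $S\subsetneq S'\subsetneq S\vee x$; (G4) for any subset $A\subseteq X$ and $x\in\overline{A}$ there is a finite subset $\{a_1,\dots,a_r\}\subseteq A$ with $x\in\overline{\{a_1,\dots,a_r\}}$. Here $\overline{A}$ is the least subspace containing $A$ and $\vee$ denotes the supremum of subspaces (closure of the union). A set $A$ is independent if $a\notin\overline{A\setminus a}$ for all $a\in A$; a basis of a subspace $S$ is an independent $A\subseteq S$ with $\overline{A}=S$; all bases of $S$ have the same cardinal, and $\dim S$ is this cardinal minus $1$. Lines and planes are the subspaces of dimension $1$ and $2$. A morphism of geometries $\varphi\colon X\to X'$ is a map such that the preimage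 of every subspace of $X'$ is a subspace of $X$; an isomorphism is a bijective morphism whose inverse is a morphism. Any subset $A$ of a geometry $X$ is a geometry (a subgeometry) whose subspaces are the sets $S\cap A$ with $S$ a subspace of $X$. A morphism $\varphi\colon X\to X'$ is an embedding if $\varphi\colon X\to\varphi(X)$ is an isomorphism, with $\varphi(X)$ considered as a subgeometry of $X'$. For a subspace $E$ of a geometry $X$, the quotient $X/\!\!/E$ is the set of classes of $X-E$ under $x_1\equiv x_2\Leftrightarrow x_1\vee E=x_2\vee E$; its subspaces are the images of the subspaces $S$ of $X$ containing $E$; it is a geometry. If $X$ is a subgeometry of $\mathbb{P}$ and $x\in X$, then $X/\!\!/x$ is identified with a subgeometry of $\mathbb{P}/\!\!/x$ through $[y]\mapsto[y]$. A projective space is a set of points with a family of subsets called lines such that: through any two different points passes a unique line; any line has two different points; if a line meets two sides of a triangle, not in the common vertex, then it also meets the third side. It is a geometry whose subspaces are the subsets containing the line joining any two different points of the subset. It is irreducible if every line has at least three points, and reducible otherwise. A geometry $X$ is locally projective if $X/\!\!/x$ is a projective space for all $x\in X$. A geometry fulfills the bundle theorem if: whenever $L_1,L_2,L_3,L_4$ are four lines such that no three of them are coplanar, if five of the six pairs $\{L_i,L_j\}_{i<j}$ are coplanar then so is the sixth pair. For a (left) vector space $V$ over a division ring, $\mathbb{P}(V)$ is the set of 1-dimensional vector subspaces of $V$, an irreducible projective space whose subspaces are the subsets $\mathbb{P}(W)$ for vector subspaces $W\subseteq V$; $\dim\mathbb{P}(W)=\dim W-1$. Minimal projective embedding: an embedding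 $X\hookrightarrow\mathbb{P}$ into a projective space such that $X/\!\!/x=\mathbb{P}/\!\!/x$ for all $x\in X$. It is known (Wyler, Kahn) that a geometry satisfying the hypotheses imposed on $X$ and $X'$ admits such an embedding, with $\mathbb{P}=\mathbb{P}(V)$ for some vector space $V$ over a division ring. A map $\Phi\colon V\to V'$ is semilinear if it is additive and there is a ring morphism $\sigma\colon K\to K'$ (not necessarily surjective) with $\Phi(\lambda v)=\sigma(\lambda)\Phi(v)$ for all $\lambda\in K$, $v\in V$. A semilinear map $\Phi$ induces a partially defined map $\mathbb{P}(V)\dashrightarrow\mathbb{P}(V')$, $\langle v\rangle\mapsto\langle\Phi(v)\rangle$, with domain $\mathbb{P}(V)-\mathbb{P}(\ker\Phi)$; such partial maps are called partial projective morphisms. *)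

(* Defs.v *)
From mathcomp Require Import all_boot ssralg.
From mathcomp Require Import boolp classical_sets functions cardinality.
Set Implicit Arguments.
Unset Strict Implicit.
Unset Printing Implicit Defensive.
Import GRing.Theory.
Local Open Scope classical_set_scope.
Local Open Scope card_scope.
Local Open Scope ring_scope.

(* A set of points with a family of subsets. The geometry axioms are kept in a
   separate predicate, so that subgeometries and quotients can be formed
   without first proving that they satisfy them. *)
Record pregeometry := Pregeometry {
  carrier :> Type;
  subspace : set (set carrier) }.
Arguments subspace : clear implicits.

Section Geometry.
Variable X : pregeometry.
Implicit Types (A B S E L : set X) (x y : X).

Definition closure A : set X :=
  \bigcap_(S in [set S | subspace X S /\ A `<=` S]) S.

Definition join A B : set X := closure (A `|` B).

Definition is_geometry : Prop :=
  [/\ [/\ subspace X set0, subspace X setT & forall x, subspace X [set x]],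
      (forall F : set (set X),
         F `<=` subspace X -> subspace X (\bigcap_(S in F) S)),
      (forall S x, subspace X S -> ~ S x ->
         ~ exists S', [/\ subspace X S', S `<` S' & S' `<` join S [set x]])
    & (forall A x, closure A x ->
         exists F, [/\ finite_set F, F `<=` A & closure F x])].

Definition independent A : Prop := forall a, A a -> ~ closure (A `\ a) a.

Definition basis S A : Prop :=
  [/\ independent A, A `<=` S & closure A = S].

(* In a geometry, all bases of a subspace are equipotent. Note that
   `I_n.+1 = {0, ..., n}; dim_ge includes infinite dimension. *)
Definition dim_eq S (n : nat) : Prop :=
  subspace X S /\ exists A, basis S A /\ A #= `I_n.+1.

Definition dim_ge S (n : nat) : Prop :=
  subspace X S /\ exists A, basis S A /\ `I_n.+1 #<= A.

Definition line L : Prop := dim_eq L 1.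
Definition plane E : Prop := dim_eq E 2.
Definition coplanar A : Prop := exists E, plane E /\ A `<=` E.

(* For all p != q: if the five pairs of lines other than {L p, L q} are
   coplanar, so is {L p, L q}. *)
Definition bundle_theorem : Prop :=
  forall L : 'I_4 -> set X,
    (forall i, line (L i)) ->
    (forall i j k, i != j -> i != k -> j != k ->
       ~ coplanar (L i `|` L j `|` L k)) ->
    forall p q, p != q ->
      (forall i j, i != j ->
         ~ (i = p /\ j = q) -> ~ (i = q /\ j = p) -> coplanar (L i `|` L j)) ->
      coplanar (L p `|` L q).

Definition quot_eq E x y : Prop := join [set x] E = join [set y] E.

Definition quot_class E x : set X := [set y | ~ E y /\ quot_eq E x y].

Definition quotient_point E : Type :=
  {C : set X | exists x, ~ E x /\ C = quot_class E x}.

Definition quotient E : pregeometry :=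
  @Pregeometry (quotient_point E)
    [set T | exists S, [/\ subspace X S, E `<=` S &
       T = [set C | exists x, [/\ S x, ~ E x & sval C = quot_class E x]]]].

Definition subgeometry A : pregeometry :=
  @Pregeometry {x : X | A x}
    [set T | exists S, subspace X S /\ T = [set u | S (sval u)]].

End Geometry.

Definition morphism (X Y : pregeometry) (f : X -> Y) : Prop :=
  forall S, subspace Y S -> subspace X (f @^-1` S).

Definition isomorphism (X Y : pregeometry) (f : X -> Y) : Prop :=
  morphism f /\ exists g : Y -> X, [/\ cancel f g, cancel g f & morphism g].

Definition corestriction (X Y : pregeometry) (f : X -> Y) :
    X -> subgeometry (range f) :=
  fun x => exist (range f) (f x) (imageT f x).

Definition embedding (X Y : pregeometry) (f : X -> Y) : Prop :=
  morphism f /\ isomorphism (corestriction f).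

Section ProjectiveSpace.
Variable T : Type.
Implicit Types (Lines : set (set T)) (L M N : set T).

Definition meets L M : Prop := exists x, L x /\ M x.

(* In the last axiom the triangle has vertices a, b, c and sides M = ab,
   N = ac, P = bc; the line L meets M and N, and avoids the common vertex a. *)
Definition projective_lines Lines : Prop :=
  [/\ (forall x y, x <> y -> exists! L, [/\ Lines L, L x & L y]),
      (forall L, Lines L -> exists x y, [/\ x <> y, L x & L y])
    & (forall a b c, [/\ a <> b, a <> c & b <> c] ->
         ~ (exists L, [/\ Lines L, L a, L b & L c]) ->
       forall M N P,
         [/\ Lines M, M a & M b] -> [/\ Lines N, N a & N c] ->
         [/\ Lines P, P b & P c] ->
       forall L, Lines L -> ~ L a -> meets L M -> meets L N -> meets L P)].

Definition irreducible_lines Lines : Prop :=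
  forall L, Lines L ->
    exists x y z, [/\ x <> y, x <> z & y <> z] /\ [/\ L x, L y & L z].

Definition line_closed Lines (S : set T) : Prop :=
  forall x y, x <> y -> S x -> S y ->
  forall L, Lines L -> L x -> L y -> L `<=` S.

End ProjectiveSpace.

Definition projective_structure (X : pregeometry) (Lines : set (set X)) : Prop :=
  projective_lines Lines /\ subspace X = line_closed Lines.

Definition projective_space (X : pregeometry) : Prop :=
  exists Lines, @projective_structure X Lines.

Definition reducible_projective_space (X : pregeometry) : Prop :=
  exists Lines, @projective_structure X Lines /\ ~ irreducible_lines Lines.

Definition locally_projective (X : pregeometry) : Prop :=
  is_geometry X /\ forall x : X, projective_space (quotient [set x]).

(* The equality X//x = P//x means that the map [y] |-> [j y] from X//x to
   P//(j x) is an isomorphism. *)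
Definition minimal_projective_embedding (X P : pregeometry) (j : X -> P) : Prop :=
  [/\ projective_space P, embedding j &
      forall x : X, exists f : quotient [set x] -> quotient [set j x],
        isomorphism f /\
        forall (C : quotient [set x]) (y : X), sval C y -> sval (f C) (j y)].

Definition division_ring (K : unitRingType) : Prop :=
  forall a : K, a != 0 -> a \is a GRing.unit.

Section ProjectivizedSpace.
Variables (K : unitRingType) (V : lmodType K).

Definition vline (v : V) : set V := [set u | exists a : K, u = a *: v].

Definition PV_point : Type := {L : set V | exists v, v != 0 /\ L = vline v}.

Definition pt_of (v : V) (v0 : v != 0) : PV_point :=
  exist _ (vline v) (ex_intro _ v (conj v0 erefl)).

Definition PV : pregeometry :=
  @Pregeometry PV_point
    [set S | exists W : {pred V}, GRing.submod_closed W /\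
       S = [set p | forall u, sval p u -> u \in W]].

End ProjectivizedSpace.

Definition semilinear (K K' : unitRingType) (V : lmodType K) (V' : lmodType K')
    (Phi : V -> V') : Prop :=
  {morph Phi : u v / u + v} /\
  exists sigma : {rmorphism K -> K'}, forall a v, Phi (a *: v) = sigma a *: Phi v.

(* Partial maps are option-valued, None meaning undefined. *)
Definition partial_projective_morphism (K K' : unitRingType)
    (V : lmodType K) (V' : lmodType K') (g : PV V -> option (PV V')) : Prop :=
  exists2 Phi : V -> V', semilinear Phi &
    forall (v : V) (v0 : v != 0),
      (Phi v = 0 -> g (pt_of v0) = None) /\
      (forall w0 : Phi v != 0, g (pt_of v0) = Some (pt_of w0)).

Definition admissible (X : pregeometry) : Prop :=
  [/\ locally_projective X, ~ reducible_projective_space X &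
      dim_ge [set: X] 4 \/ (dim_eq [set: X] 3 /\ bundle_theorem X)].

(* Main.v *)
Require Import Defs.
From HB Require Import structures.
From mathcomp Require Import all_boot ssralg.
From mathcomp Require Import boolp classical_sets functions cardinality.
Set Implicit Arguments.
Unset Strict Implicit.
Unset Printing Implicit Defensive.
Import GRing.Theory.
Local Open Scope classical_set_scope.
Local Open Scope card_scope.
Local Open Scope ring_scope.

(** Choose a vector [e x] of [V] on each point [j x], and a vector [f x] of [V']
    on each point [j' (phi x)]. A morphism of geometries preserves dependence: if
    [e x] lies in the span of some [e y], then [f x] lies in the span of the
    corresponding [f y]. Minimality of the embedding says that every line of
    [PV V] through a point of [X] carries a second point of [X]. The hypothesis on
    the image says that no three vectors span all the [f x].

    These three facts suffice. For a vector [v], join [v] to the points [x] of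
    [X]; each joining line contains a second point [y] of [X], and the lines
    <f x, f y> are pairwise coplanar because the lines <e x, e y> all pass
    through [v]. In a space of rank at least 4, lines that are pairwise coplanar
    but not all in one plane are concurrent: they meet in a point <q v>, the only
    possible image of <v>. When instead [f x] and [f y] are proportional for all
    these pairs, [q v = 0] and the extension is undefined at <v>. The
    argument starts from three independent lines through [q v]: the image of a
    point [x] off [q v] avoids one of the three planes that they span, and
    being coplanar with both lines of that plane forces the line from [x] through
    [q v] ([through_step], [through_all]).

    The map [q] respects spans of two vectors: project the three vectors from a
    point of [X] whose image is in general position, and use that [phi] is a
    morphism ([image_at_span]). The fundamental theorem of projective geometry,
    proved here for partial maps given by a choice of vectors
    ([fundamental_theorem]), then rescales [q] to a semilinear map. Uniqueness
    comes from the same source: two semilinear maps inducing [phi] on [X] both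
    take [v] to a possible image of [v], and [image_at_span] with all vectors
    equal to [v] shows that any two of these are proportional. *)

(** * Spans over a division ring *)

Section Span.
Variables (K : unitRingType) (V : lmodType K).
Implicit Types (s t : seq V) (u v w x y z : V).

Fixpoint span s : set V :=
  if s is x :: s' then [set v | exists a : K, span s' (v - a *: x)] else [set 0].

Lemma span_submod s :
  [/\ span s 0, forall u v, span s u -> span s v -> span s (u + v)
    & forall a u, span s u -> span s (a *: u)].
Proof.
elim: s => [|x s [s0 sD sZ]] /=; first split=> //.
- by move=> u v -> ->; rewrite addr0.
- by move=> a u ->; rewrite scaler0.
split=> [|u v [a su] [b sv]|a u [b su]].
- by exists 0; rewrite scale0r subr0.
- by exists (a + b); rewrite scalerDl opprD addrACA; exact: sD.
- by exists (a * b); rewrite -scalerA -scalerBr; exact: sZ.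
Qed.

Lemma span0 s : span s 0. Proof. by have [] := span_submod s. Qed.

Lemma spanD s u v : span s u -> span s v -> span s (u + v).
Proof. by have [_ sD _] := span_submod s; exact: sD. Qed.

Lemma spanZ s a u : span s u -> span s (a *: u).
Proof. by have [_ _ sZ] := span_submod s; exact: sZ. Qed.

Lemma spanN s u : span s u -> span s (- u).
Proof. by rewrite -scaleN1r; exact: spanZ. Qed.

Lemma spanB s u v : span s u -> span s v -> span s (u - v).
Proof. by move=> su sv; apply: spanD => //; apply: spanN. Qed.

Lemma span_consr s x v : span s v -> span (x :: s) v.
Proof. by move=> sv; exists 0; rewrite scale0r subr0. Qed.

Lemma span_head s x : span (x :: s) x.
Proof. by exists 1; rewrite scale1r subrr; exact: span0. Qed.

Lemma span_scale s a x : span (x :: s) (a *: x).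
Proof. by apply: spanZ; exact: span_head. Qed.

Lemma span_mem s x : x \in s -> span s x.
Proof.
elim: s => //= y s IHs; rewrite inE => /predU1P[->|/IHs]; first exact: span_head.
exact: span_consr.
Qed.

Lemma span_min (W : set V) s :
    W 0 -> (forall u v, W u -> W v -> W (u + v)) ->
    (forall a u, W u -> W (a *: u)) ->
  (forall x, x \in s -> W x) -> span s `<=` W.
Proof.
move=> W0 WD WZ; elim: s => [|x s IHs] sW v; first by move=> ->.
move=> [a /IHs Wva]; rewrite -(subrK (a *: x) v); apply: WD.
  by apply: Wva => y ys; apply: sW; rewrite inE ys orbT.
by apply: WZ; apply: sW; rewrite mem_head.
Qed.

Lemma span_sub s t : (forall x, x \in s -> span t x) -> span s `<=` span t.
Proof. by apply: span_min; [exact: span0|exact: spanD|exact: spanZ]. Qed.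

Lemma span1P x v : span [:: x] v <-> exists a, v = a *: x.
Proof.
split=> [[a /= /eqP]|[a ->]]; last by apply/spanZ/span_head.
by rewrite subr_eq0 => /eqP ->; exists a.
Qed.

Lemma span2P x y v : span [:: x; y] v <-> exists a b, v = a *: x + b *: y.
Proof.
split=> [[a /span1P[b vE]]|[a [b ->]]].
  by exists a, b; rewrite -vE addrC subrK.
by exists a; rewrite addrC addKr; apply/span1P; exists b.
Qed.

End Span.

(** [span_from H] proves [span t v] from [H : span s v] when each generator in
    [s] is in [t], or is known to be in the span of some members of [t]. *)
Ltac span_gens tac :=
  let z := fresh "z" in
  let zs := fresh "zs" in
  move=> z; rewrite !inE => zs;
  repeat (case/orP: zs => zs);
  move/eqP: zs => ->;
  first [ by apply: span_mem; rewrite !inE eqxx ?orbT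
        | assumption | exact: span0 | tac ].
Ltac span_from H :=
  apply: (span_sub _ H);
  span_gens ltac:(idtac; match goal with
    | G : span _ ?x |- span _ ?x => solve [apply: (span_sub _ G); span_gens fail]
    end).

Section DivisionRingSpan.
Variables (K : unitRingType) (V : lmodType K) (hK : division_ring K).
Implicit Types (s t : seq V) (u v w x y z : V).

Lemma span_exchange s x v : span (x :: s) v -> ~ span s v -> span (v :: s) x.
Proof.
move=> [a sa] nsv; have [a0|/hK ua] := eqVneq a 0.
  by case: nsv; move: sa; rewrite a0 scale0r subr0.
exists a^-1; rewrite -[x]scale1r -(mulVr ua) -scalerA -scalerBr -opprB scalerN.
by apply: spanN; apply: spanZ.
Qed.

(** Distinct subspaces with a common hyperplane meet in that hyperplane. *)
Lemma span_meet s x y v :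
  span (x :: s) v -> span (y :: s) v -> ~ span (x :: s) y -> span s v.
Proof.
move=> sxv syv nsy; apply: contrapT => nsv; apply: nsy.
apply: span_sub (span_exchange syv nsv) => z; rewrite inE => /predU1P[->//|zs].
by apply: span_mem; rewrite inE zs orbT.
Qed.

Lemma span1_sym x v : span [:: x] v -> v != 0 -> span [:: v] x.
Proof. by move=> xv v0; apply: span_exchange xv _ => /= /eqP; apply/negP. Qed.

(** Two points of a line whose difference lies in a subspace are equal unless the
    line lies in that subspace. *)
Lemma line_inj p s z z' :
  span [:: p] z -> span [:: p] z' -> span s (z - z') -> ~ span s z -> z = z'.
Proof.
move=> pz pz' szz' nsz; apply/eqP; rewrite -subr_eq0; apply: contrapT => /negP d0.
apply: nsz.
have pd : span [:: z - z'] p by apply: span1_sym d0; apply: spanB.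
have dz : span [:: z - z'] z by span_from pz.
by span_from dz.
Qed.

Fixpoint free s : Prop := if s is x :: s' then ~ span s' x /\ free s' else True.

(** Steinitz exchange of one vector: [x] replaces the first generator of [t] whose
    successors, together with [s], no longer span [x]. *)
Lemma exchange_seq t s x : span (t ++ s) x -> ~ span s x ->
  exists t', (size t').+1 = size t /\
    (forall y, y \in t ++ s -> span (x :: t' ++ s) y).
Proof.
elim: t => [//|y t IHt]; rewrite cat_cons => xs nxs.
have [xts|nxts] := pselect (span (t ++ s) x).
  have [t' [st' tt']] := IHt xts nxs.
  exists (y :: t'); split=> [|z]; first by rewrite /= st'.
  rewrite inE => /predU1P[->|/tt' ztt'].
    by apply: span_mem; rewrite !inE eqxx orbT.
  apply: span_sub ztt' => w; rewrite inE => w'; apply: span_mem.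
  by rewrite !inE orbCA w' orbT.
exists t; split=> // z; rewrite inE => /predU1P[->|zts].
  exact: span_exchange.
by apply: span_mem; rewrite inE zts orbT.
Qed.

Lemma steinitz s t : free s -> (forall x, x \in s -> span t x) -> size s <= size t.
Proof.
move=> fs st.
have [t' [tE _]] : exists t', (size s + size t' = size t)%N /\
    forall x, x \in t -> span (t' ++ s) x.
  elim: s fs st => [|x s IHs] /= => [_ _|[nxs /IHs{}IHs] st].
    by exists t; split=> // x xt; apply: span_mem; rewrite mem_cat xt.
  have [y ys|t' [tE tt']] := IHs; first by apply: st; rewrite inE ys orbT.
  have [|t'' [tE' tt'']] := @exchange_seq t' s x _ nxs.
    by apply: span_sub (st x (mem_head _ _)).
  exists t''; split=> [|y /tt' yt']; first by rewrite -tE -tE' addSn addnS.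
  apply: span_sub yt' => z /tt''; apply: span_sub => w.
  rewrite inE mem_cat => w'; apply: span_mem.
  by rewrite mem_cat inE orbCA.
by rewrite -tE leq_addr.
Qed.

End DivisionRingSpan.

(** * The fundamental theorem of projective geometry *)

Lemma rmorphism_of (R S : pzRingType) (s : R -> S) :
  {morph s : a b / a + b} -> s 1 = 1 -> {morph s : a b / a * b} ->
  exists t : {rmorphism R -> S}, t =1 s.
Proof.
move=> sD s1 sM.
have s0 : s 0 = 0 by apply: (addrI (s 0)); rewrite -sD !addr0.
have sB : {morph s : a b / a - b}.
  by move=> a b; apply: (addIr (s b)); rewrite -sD !subrK.
pose t : {rmorphism R -> S} := HB.pack s
  (GRing.isZmodMorphism.Build R S s sB)
  (GRing.isMonoidMorphism.Build R S s (conj s1 sM)).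
by exists t.
Qed.

Section FundamentalTheorem.
Variables (K K' : unitRingType) (V : lmodType K) (V' : lmodType K').
Hypotheses (hK : division_ring K) (hK' : division_ring K').
Variable q : V -> V'.
Hypothesis q_span : forall u v w, span [:: u; v] w -> span [:: q u; q v] (q w).
Hypothesis q_rank : forall x y, exists v, ~ span [:: x; y] (q v).

Lemma q_line u w : span [:: u] w -> span [:: q u] (q w).
Proof.
move=> uw; have uuw : span [:: u; u] w by span_from uw.
by have H := q_span uuw; span_from H.
Qed.

Lemma q_span_line u v w w' :
  span [:: u; v] w -> span [:: q w] w' -> span [:: q u; q v] w'.
Proof. by move=> /q_span uvw ww'; span_from ww'. Qed.

(** The vectors [u'] and [v'], on the lines of [q u] and [q v], have matching scales
    when their sum falls on the line of [q (u + v)], as it does for the values of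
    an additive map. *)
Definition compat u u' v v' : Prop :=
  [/\ span [:: q u] u', span [:: q v] v' & span [:: q (u + v)] (u' + v')].

Lemma compat_sym u u' v v' : compat u u' v v' -> compat v v' u u'.
Proof. by case=> ? ? ?; split=> //; rewrite addrC [v' + _]addrC. Qed.

Lemma sub_gen (u v : V) : span [:: u + v; v] u.
Proof.
by rewrite -{2}[u](addrK v); apply: spanB; apply: span_mem; rewrite !inE eqxx ?orbT.
Qed.

Lemma add_gen (u v : V) : span [:: u; v] (u + v).
Proof. by apply: spanD; apply: span_mem; rewrite !inE eqxx ?orbT. Qed.

(** Decompose [u'] along [q (u + v)] and [q v]: moving the second component to the
    other side gives [v']. *)
Lemma compat_ex u u' v : span [:: q u] u' -> exists v', compat u u' v v'.
Proof.
move=> uu'; have /span2P[a [b uE]] := q_span_line (sub_gen u v) uu'.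
exists (- (b *: q v)); split=> //; first by apply: spanN; exact: span_scale.
by rewrite uE addrK; exact: span_scale.
Qed.

Lemma compat_uniq u u' v v1 v2 : ~ span [:: q v] u' ->
  compat u u' v v1 -> compat u u' v v2 -> v1 = v2.
Proof.
move=> nu [_ vv1 s1] [_ vv2 s2]; apply: (addrI u').
apply: (line_inj hK' s1 s2 (s := [:: q v])).
  by rewrite opprD addrACA subrr add0r; exact: spanB.
by move=> H; apply: nu; rewrite -[u'](addrK v1); exact: spanB.
Qed.

Lemma compat_neq0 u u' v v' : u' != 0 -> ~ span [:: q u] (q v) ->
  compat u u' v v' -> v' != 0.
Proof.
move=> u0 nuv [uu' _ suv]; apply/eqP => v0; apply: nuv.
rewrite v0 addr0 in suv.
have {}suv : span [:: q u] (q (u + v)).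
  by have H := span1_sym hK' suv u0; span_from H.
have uv : span [:: u + v; u] v by rewrite addrC; exact: sub_gen.
have H := q_span uv; by span_from H.
Qed.

(** The decompositions [(u + v) + w] and [(u + w) + v] put the image of [u + v + w]
    on two lines of the projective space, which meet in [u' + v' + w'];
    projecting it from [q u] gives the image of [v + w]. *)
Lemma compat_trans u u' v v' w w' :
    ~ span [:: q v; q w] u' ->
    (forall z, span [:: q v] z -> span [:: q w] z -> z = 0) ->
    compat u u' v v' -> compat u u' w w' ->
  compat v v' w w' /\ compat u u' (v + w) (v' + w').
Proof.
move=> nu vw0 [uu' vv' suv] [_ ww' suw].
have tE : u + v + w = u + w + v by rewrite addrAC.
have /span2P[a [b abE]] := q_span_line (sub_gen (u + v) w) suv.
have /span2P[c [d cdE]] := q_span_line (sub_gen (u + w) v) suw.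
pose w1 := - (b *: q w); pose v1 := - (d *: q v).
have ww1 : span [:: q w] w1 by apply: spanN; exact: span_scale.
have vv1 : span [:: q v] v1 by apply: spanN; exact: span_scale.
have p1 : span [:: q (u + v + w)] (u' + v' + w1).
  by rewrite abE /w1 addrK; exact: span_scale.
have p2 : span [:: q (u + v + w)] (u' + w' + v1).
  by rewrite cdE /v1 addrK tE; exact: span_scale.
have [vvw www] : span [:: q v] `<=` span [:: q v; q w] /\
                 span [:: q w] `<=` span [:: q v; q w].
  by split=> z zz; span_from zz.
have pE : u' + v' + w1 = u' + w' + v1.
  apply: (line_inj hK' p1 p2 (s := [:: q v; q w])).
    rewrite -(addrA u' v') -(addrA u' w') opprD addrACA subrr add0r.
    by apply: spanB; apply: spanD; auto.
  move=> H; apply: nu; rewrite -[u'](addrK (v' + w1)) addrA.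
  by apply: spanB => //; apply: spanD; auto.
have w1E : w1 = w'.
  apply/eqP; rewrite -subr_eq0; apply/eqP/vw0; last exact: spanB.
  have -> : w1 - w' = v1 - v'; last exact: spanB.
  apply/eqP; rewrite subr_eq addrAC eq_sym subr_eq addrC -(inj_eq (addrI u')) !addrA.
  by rewrite -pE addrAC.
have p3 : span [:: q (u + (v + w))] (u' + (v' + w')) by rewrite !addrA -w1E.
have /span2P[e [f efE]] := q_span_line (add_gen u (v + w)) p3.
have vwf : span [:: q v; q w] (f *: q (v + w)).
  by apply: spanZ; apply: q_span; exact: add_gen.
have fE : u' - e *: q u = f *: q (v + w) - (v' + w').
  by apply/eqP; rewrite subr_eq addrAC eq_sym subr_eq addrC -efE.
have uE : u' = e *: q u.
  apply: (line_inj hK' uu' _ (s := [:: q v; q w])) => //.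
    exact: span_scale.
  by rewrite fE; apply: spanB => //; apply: spanD; auto.
have vwE : span [:: q (v + w)] (v' + w').
  have -> : v' + w' = f *: q (v + w); last exact: span_scale.
  by apply/eqP; rewrite eq_sym -subr_eq0 -fE uE subrr.
by split; split.
Qed.

(** Scaling two of the three vectors against the first makes them compatible with
    each other, by [compat_trans]. *)
Lemma frame_ex : exists (e : 'I_3 -> V) (e' : 'I_3 -> V'),
  [/\ forall i, span [:: q (e i)] (e' i),
      forall i k, i != k ->
        compat (e i) (e' i) (e k) (e' k) /\ ~ span [:: q (e k)] (e' i)
    & forall x y, exists i, ~ span [:: x; y] (e' i)].
Proof.
have [v1 n1] := q_rank 0 0.
have [v2 n2] := q_rank 0 (q v1).
have [v3 n3] := q_rank (q v2) (q v1).
have c11 : span [:: q v1] (q v1) by apply: span_head.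
have [w2 c2] := compat_ex v2 c11; have [w3 c3] := compat_ex v3 c11.
have w1n : q v1 != 0 by apply/eqP => w0; apply: n1; rewrite w0; apply: span0.
have n21 : ~ span [:: q v1] (q v2) by move=> H; apply: n2; span_from H.
have n31 : ~ span [:: q v1] (q v3) by move=> H; apply: n3; span_from H.
have w2n : w2 != 0 := compat_neq0 w1n n21 c2.
have w3n : w3 != 0 := compat_neq0 w1n n31 c3.
have [_ s2 _] := c2; have [_ s3 _] := c3.
have g2 := span1_sym hK' s2 w2n; have g3 := span1_sym hK' s3 w3n.
have n12 : ~ span [:: q v2] (q v1).
  by move=> H; apply: n21; apply: (span1_sym hK') => //.
have n32 : ~ span [:: q v2] (q v3) by move=> H; apply: n3; span_from H.
have n123 : ~ span [:: q v2; q v3] (q v1).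
  move=> H; apply: n3.
  have H' : span [:: q v3; q v2] (q v1) by span_from H.
  have := span_exchange hK' H' n12 => H''; span_from H''.
have [c23 _] : compat v2 w2 v3 w3 /\ compat v1 (q v1) (v2 + v3) (w2 + w3).
  apply: compat_trans n123 _ c2 c3 => z z2 z3; apply/eqP/negP => /negP z0.
  by apply: n32; have := span1_sym hK' z3 z0 => H; span_from H.
exists (fun i => nth 0 [:: v1; v2; v3] i), (fun i => nth 0 [:: q v1; w2; w3] i).
split; first by case=> [[|[|[|i]]] ilt].
  have aux u u' w w' : compat u u' w w' -> ~ span [:: q w] (q u) -> u' != 0 ->
    compat u u' w w' /\ ~ span [:: q w] u'.
    move=> c n u0; split=> // H; apply: n; have [uu _ _] := c.
    by have H' := span1_sym hK' uu u0; span_from H'.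
  have q1 : ~ span [:: q v3] (q v1) by move=> H; apply: n123; span_from H.
  have q2 : ~ span [:: q v3] (q v2).
    move=> H; apply: n32; apply: (span1_sym hK') => //.
    by apply/eqP => z; apply: n21; rewrite z; apply: span0.
  by case=> [[|[|[|i]]] ilt] [[|[|[|k]]] klt] // _; apply: aux => //; apply: compat_sym.
move=> x y; apply: contrapT => nxy.
have xy i : span [:: x; y] (nth 0 [:: q v1; w2; w3] (i : 'I_3)).
  by apply: contrapT => H; apply: nxy; exists i.
suff : (3 <= 2)%N by [].
apply: (steinitz hK' (s := [:: q v3; q v2; q v1]) (t := [:: x; y])).
  by split=> //; split=> //; split=> //; exact/eqP.
have h1 := xy ord0; have h2 := xy (Ordinal (isT : 1 < 3)%N); have h3 := xy ord_max.
move=> z; rewrite !inE => /or3P[]/eqP -> //.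
  by span_from g3.
by span_from g2.
Qed.

Section Coordinates.
Variables (I : eqType) (e : I -> V) (e' : I -> V').
Hypothesis e_gen : forall i, span [:: q (e i)] (e' i).
Hypothesis e_compat : forall i k, i != k ->
  compat (e i) (e' i) (e k) (e' k) /\ ~ span [:: q (e k)] (e' i).
Hypothesis e_rank : forall x y, exists i, ~ span [:: x; y] (e' i).

Lemma e_neq0 i : e' i != 0.
Proof.
have [k nk] := e_rank (e' i) 0; have [ki|ik] := eqVneq k i.
  by case: nk; rewrite ki; apply: span_head.
rewrite eq_sym in ik; have [_ H] := e_compat ik.
by apply/eqP => z; apply: H; rewrite z; apply: span0.
Qed.

Lemma e_gen_sym i : span [:: e' i] (q (e i)).
Proof. exact: span1_sym (e_gen i) (e_neq0 i). Qed.

(** The frame vectors whose images are on the line of [q v] cannot detect the scale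
    of [v'], hence the condition on [i]. *)
Definition value v v' : Prop := span [:: q v] v' /\
  forall i, ~ span [:: q v] (e' i) -> compat (e i) (e' i) v v'.

(** Compatibility with [v] passes from [e i] to [e k] when [q v] is off the
    line joining their images. *)
Lemma compat_step i k v v' : i != k ->
    ~ span [:: e' k; q v] (e' i) -> ~ span [:: q v] (e' k) ->
  compat (e i) (e' i) v v' -> compat (e k) (e' k) v v'.
Proof.
move=> ik ni nk ci; have [cik _] := e_compat ik.
have ek := e_gen k; have ek' := e_gen_sym k.
suff [//] : compat (e k) (e' k) v v' /\ compat (e i) (e' i) (e k + v) (e' k + v').
apply: compat_trans cik ci.
  by move=> H; apply: ni; span_from H.
move=> z z1 z2; apply/eqP/negP => /negP z0; apply: nk.
have H := span1_sym hK' z1 z0; have H' : span [:: z] (e' k) by span_from ek.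
by span_from H'.
Qed.

Lemma value_ex v : exists v', value v v'.
Proof.
have [i ni] := e_rank (q v) 0.
have {}ni : ~ span [:: q v] (e' i) by move=> H; apply: ni; span_from H.
have [v' ci] := compat_ex v (e_gen i).
exists v'; split=> [|k nk]; first by case: ci.
have [<-//|ik] := eqVneq i k.
have [iv|nik] := pselect (span [:: e' k; q v] (e' i)); last exact: compat_step ci.
(* Here [q v] lies on the line joining the images of [e i] and [e k]: go around
   through a third vector, off that line. *)
have vik : span [:: e' i; e' k] (q v).
  have iv' : span [:: q v; e' k] (e' i) by span_from iv.
  apply: (span_exchange hK' iv') => H; have [_] := e_compat ik; apply.
  by have ek := e_gen k; span_from H.
have [l nl] := e_rank (e' i) (e' k).
have il : i != l by apply: contra_notN nl => /eqP <-; apply: span_head.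
have hk : span [:: e' i; e' k] (e' k) by apply: span_mem; rewrite !inE eqxx orbT.
have lk : l != k by apply: contra_notN nl => /eqP ->.
have nlv : ~ span [:: q v] (e' l) by move=> H; apply: nl; span_from H.
apply: (compat_step lk) nk _.
  by move=> H; apply: nl; span_from H.
apply: (compat_step il) nlv ci => H; apply: nl.
have H' := span_exchange hK' H ni.
have hi : span [:: e' i; e' k] (e' i) by apply: span_head.
by span_from H'.
Qed.

Variable Phi : V -> V'.
Hypothesis Phi_value : forall v, value v (Phi v).

Lemma Phi_line v : span [:: q v] (Phi v).
Proof. by have [] := Phi_value v. Qed.

Lemma Phi_uniq v v' i :
  ~ span [:: q v] (e' i) -> compat (e i) (e' i) v v' -> v' = Phi v.
Proof.
move=> nv cv; apply: (compat_uniq nv cv).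
by have [_] := Phi_value v; apply.
Qed.

Lemma e_avoid x : exists i, ~ span [:: x] (e' i).
Proof.
have [i ni] := e_rank x 0; exists i => H; apply: ni; span_from H.
Qed.

Lemma Phi_gen v : span [:: Phi v] (q v).
Proof.
have [->|v0] := eqVneq (q v) 0; first exact: span0.
apply: span1_sym (Phi_line v) _ => //.
have [i ni] := e_avoid (q v); have [_ /(_ _ ni) ci] := Phi_value v.
apply: compat_neq0 (e_neq0 i) _ ci => H; apply: ni.
have H' := span1_sym hK' H v0; have ei := e_gen i; by span_from ei.
Qed.

(** A frame vector [e i] with image off the span of [q u] and [q v] carries
    [compat_trans] from [u] and [v] to [u + v]. *)
Lemma PhiD_indep u v : (forall z, span [:: q u] z -> span [:: q v] z -> z = 0) ->
  Phi (u + v) = Phi u + Phi v.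
Proof.
move=> uv0; have [i ni] := e_rank (q u) (q v).
have nu : ~ span [:: q u] (e' i) by move=> H; apply: ni; span_from H.
have nv : ~ span [:: q v] (e' i) by move=> H; apply: ni; span_from H.
have [_ /(_ _ nu) cu] := Phi_value u; have [_ /(_ _ nv) cv] := Phi_value v.
have [_ cuv] := compat_trans ni uv0 cu cv.
apply/esym/(Phi_uniq (i := i)) => // H; apply: ni.
by have Huv := q_span (add_gen u v); span_from H.
Qed.

Lemma lines_meet0 (x y : V') : ~ span [:: x] y ->
  forall z, span [:: x] z -> span [:: y] z -> z = 0.
Proof.
move=> nxy z xz yz; apply/eqP/negP => /negP z0; apply: nxy.
have H := span1_sym hK' yz z0; by span_from H.
Qed.

Lemma PhiD : {morph Phi : u v / u + v}.
Proof.
move=> u v.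
have [uv0|uv] := pselect (forall z, span [:: q u] z -> span [:: q v] z -> z = 0).
  exact: PhiD_indep.
have quv : span [:: q u] (q v).
  by apply: contrapT => /lines_meet0.
have qu0 : q u != 0.
  apply/eqP => u0; apply: uv => z; rewrite u0 => /span1P[a ->]; by rewrite scaler0.
have [i ni] := e_avoid (q u).
have ei := e_gen i.
have nvi : ~ span [:: q v] (e' i) by move=> H; apply: ni; span_from H.
have nui : ~ span [:: q u] (q (e i)) by move=> H; apply: ni; span_from ei.
have nvi' : ~ span [:: q v] (q (e i)) by move=> H; apply: nui; span_from H.
(* Evaluate on [u + v + e i] in two ways: the line of [q (e i)] differs from the
   common line of [q u] and [q v]. *)
apply: (addIr (Phi (e i))).
have nuvi : ~ span [:: q (u + v)] (q (e i)).
  move=> H; apply: nui; have Huv := q_span (add_gen u v).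
  have H' : span [:: q u; q v] (q (e i)) by span_from H.
  by span_from H'.
rewrite -(PhiD_indep (lines_meet0 nuvi)) -[in LHS]addrA.
rewrite PhiD_indep; last first.
  apply: lines_meet0 => H; apply: nui.
  have H1 : span [:: v + e i; v] (e i) by rewrite addrC; exact: sub_gen.
  have H2 := q_span H1; by span_from H2.
by rewrite (PhiD_indep (lines_meet0 nvi')) addrA.
Qed.

Lemma PhiZ a v : span [:: Phi v] (Phi (a *: v)).
Proof.
have H : span [:: v] (a *: v) by exact: span_scale.
have H1 := Phi_line (a *: v); have H2 := q_line H; have H3 := Phi_gen v.
have H4 : span [:: Phi v] (q (a *: v)) by span_from H2.
by span_from H1.
Qed.

(** Independent vectors have the same multiplier, because [u + v] has one too. *)
Lemma PhiZ_indep a u v b c : Phi u != 0 -> ~ span [:: Phi u] (Phi v) ->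
  Phi (a *: u) = b *: Phi u -> Phi (a *: v) = c *: Phi v -> b = c.
Proof.
move=> u0 nuv ub vc; have /span1P[d] := PhiZ a (u + v).
rewrite scalerDr !PhiD ub vc scalerDr => dE.
have dE' : (b - d) *: Phi u = (d - c) *: Phi v.
  rewrite !scalerBl; apply/eqP; rewrite subr_eq addrAC eq_sym subr_eq; apply/eqP.
  by rewrite dE addrC.
have dc0 : d - c = 0.
  apply/eqP; apply: contrapT => /negP/hK' ud; apply: nuv; apply/span1P.
  by exists ((d - c)^-1 * (b - d)); rewrite -scalerA dE' scalerA mulVr // scale1r.
have bd0 : b - d = 0.
  apply/eqP; apply: contrapT => /negP/hK' ub'; case/eqP: u0.
  by rewrite -[Phi u]scale1r -(mulVr ub') -scalerA dE' dc0 scale0r scaler0.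
by move/eqP: dc0; move/eqP: bd0; rewrite !subr_eq0 => /eqP -> /eqP.
Qed.

Lemma scale_inj a b (x : V') : x != 0 -> a *: x = b *: x -> a = b.
Proof.
move=> x0 /eqP; rewrite -subr_eq0 -scalerBl => /eqP abx; apply/eqP; rewrite -subr_eq0.
apply: contrapT => /negP/hK' uab; case/eqP: x0.
by rewrite -[x]scale1r -(mulVr uab) -scalerA abx scaler0.
Qed.

Lemma Phi_semilinear : Defs.semilinear Phi.
Proof.
split; first exact: PhiD.
have [v0 nv0] := q_rank 0 0; have [v1 nv1] := q_rank (q v0) 0.
have /choice[s sE] : forall a, exists b, Phi (a *: v0) = b *: Phi v0.
  by move=> a; apply/span1P; exact: PhiZ.
have n0 : Phi v0 != 0.
  apply/eqP => z; apply: nv0; have := Phi_gen v0; rewrite z => H; span_from H.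
have n01 : ~ span [:: Phi v0] (Phi v1).
  move=> H; apply: nv1; have H1 := Phi_gen v1; have H2 := Phi_line v0.
  have H3 : span [:: q v0] (Phi v1) by span_from H.
  by span_from H1.
have sP a v : Phi (a *: v) = s a *: Phi v.
  have [b bE] : exists b, Phi (a *: v) = b *: Phi v by apply/span1P; exact: PhiZ.
  have [z|nz] := eqVneq (Phi v) 0; first by rewrite bE z !scaler0.
  rewrite bE; congr (_ *: _).
  have [H|H] := pselect (span [:: Phi v0] (Phi v)); last exact/esym/(PhiZ_indep n0 H).
  have [c cE] : exists b, Phi (a *: v1) = b *: Phi v1 by apply/span1P; exact: PhiZ.
  rewrite (PhiZ_indep n0 n01 (sE a) cE); apply: (PhiZ_indep nz _ bE cE) => H'.
  by apply: n01; span_from H'.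
have [t tE] : exists t : {rmorphism K -> K'}, t =1 s.
  apply: rmorphism_of.
  - by move=> a b; apply: (scale_inj n0); rewrite -sP scalerDl PhiD !sP scalerDl.
  - by apply: (scale_inj n0); rewrite -sP !scale1r.
  - by move=> a b; apply: (scale_inj n0); rewrite -sP -scalerA !sP scalerA.
by exists t => a v; rewrite tE.
Qed.

End Coordinates.

(** The scale of [Phi v] inside the line of [q v] is fixed by compatibility with
    the vectors of a frame. *)
Theorem fundamental_theorem : exists Phi : V -> V',
  Defs.semilinear Phi /\ forall v, span [:: q v] (Phi v) /\ span [:: Phi v] (q v).
Proof.
have [e [e' [eg ec er]]] := frame_ex.
have [Phi PhiP] := choice (value_ex eg ec er).
exists Phi; split; first exact: (Phi_semilinear eg ec er PhiP).
by move=> v; split; [exact: (Phi_line PhiP)|exact: (Phi_gen eg ec er)].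
Qed.

End FundamentalTheorem.

(** * Extension of a morphism to the ambient projective space *)

Section Extension.
Variables (K K' : unitRingType) (V : lmodType K) (V' : lmodType K').
Hypotheses (hK : division_ring K) (hK' : division_ring K').
Variables (X : Type) (e : X -> V) (f : X -> V').
Hypothesis e_line : forall v x, exists y,
  span [:: e x; e y] v /\ span [:: e x; v] (e y).
Hypothesis ef_span : forall x y1 y2 y3,
  span [:: e y1; e y2; e y3] (e x) -> span [:: f y1; f y2; f y3] (f x).
Hypothesis f_neq0 : forall x, f x != 0.
Hypothesis f_rank : forall p q r, exists x, ~ span [:: p; q; r] (f x).

(** The line of [q] is where an extension of [f] may send the line of [v]. For two
    points of [X] on a line through [v], it must lie on the line joining their
    images; conversely the image of the second point must lie on the line
    joining the image of the first to [q], which is vacuous when these two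
    coincide. The value [q = 0] encodes that the extension is undefined. *)
Definition image_at v q : Prop := forall x y,
  span [:: e x; e y] v -> span [:: e x; v] (e y) ->
  span [:: f x; f y] q /\ (~ span [:: q] (f x) -> span [:: f x; q] (f y)).

Lemma ef_span2 x y1 y2 : span [:: e y1; e y2] (e x) -> span [:: f y1; f y2] (f x).
Proof.
move=> H; have H' : span [:: f y1; f y2; f y2] (f x) by apply: ef_span; span_from H.
by span_from H'.
Qed.

Lemma image_at_point x : image_at (e x) (f x).
Proof. by move=> y z xyz zyx; split=> [|_]; apply: ef_span2. Qed.

Section OutsidePoint.
Variable v : V.
Hypothesis v_out : forall x, ~ span [:: e x] v.

(** Two lines through [v] are coplanar, so their images are. *)
Lemma ef_coplanar a b c d : span [:: e a; e b] v -> span [:: e c; e d] v ->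
  span [:: f a; f b; f c] (f d).
Proof.
move=> vab vcd; apply: ef_span.
have vdc : span [:: e d; e c] v by span_from vcd.
have H := span_exchange hK vdc (@v_out c); by span_from H.
Qed.

(** The last two conditions say that the span of [f x] and [f y] is the span of
    [f x] and [q]: a line of [PV V'], by the second condition. *)
Definition through q x y : Prop :=
  [/\ span [:: e x; e y] v, ~ span [:: q] (f x),
      span [:: f x; f y] q & span [:: f x; q] (f y)].

(** The line through the images of [g] and [h] lies in a plane with each of the
    two given lines through [q], hence is the intersection of two distinct
    planes through [f g] and [q]. *)
Lemma through_step q a b c d g h : q != 0 -> through q a b -> through q c d ->
  ~ span [:: f a; q] (f c) -> span [:: e g; e h] v ->
  ~ span [:: f a; f c; q] (f g) -> through q g h.
Proof.
move=> q0 [vab na qab bab] [vcd nc qcd dcd] nac vgh ng.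
have nqg : ~ span [:: q] (f g) by move=> H; apply: ng; span_from H.
have h1 : span [:: f a; f g; q] (f h) by have H := ef_coplanar vab vgh; span_from H.
have h2 : span [:: f c; f g; q] (f h) by have H := ef_coplanar vcd vgh; span_from H.
have hgq : span [:: f g; q] (f h).
  apply: (span_meet hK' h1 h2) => H; apply: ng.
  have H1 : span [:: f g; f a; q] (f c) by span_from H.
  have H2 := span_exchange hK' H1 nac; by span_from H2.
split=> //.
have hqg : span [:: q; f g] (f h) by span_from hgq.
have [hg|nhg] := pselect (span [:: f g] (f h)); last first.
  by have H := span_exchange hK' hqg nhg; span_from H.
have bag : span [:: f g; f a] (f b) by have H := ef_coplanar vgh vab; span_from H.
have qag : span [:: f g; f a] q by span_from qab.
case: ng; have nqa : ~ span [:: f a] q by move=> H; apply: na; exact: span1_sym.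
have H := span_exchange hK' qag nqa; by span_from H.
Qed.

(** The three planes spanned by three independent lines through [q] have only [q]
    in common, so a point [f x] different from [q] is off one of them. *)
Lemma through_all q a a' b b' c c' : q != 0 ->
    through q a a' -> through q b b' -> through q c c' ->
    ~ span [:: f a; q] (f b) -> ~ span [:: f a; f b; q] (f c) ->
  forall x y, span [:: e x; e y] v -> ~ span [:: q] (f x) -> through q x y.
Proof.
move=> q0 ta tb tc nab nabc x y vxy nx.
have nac : ~ span [:: f a; q] (f c) by move=> H; apply: nabc; span_from H.
have nbc : ~ span [:: f b; q] (f c) by move=> H; apply: nabc; span_from H.
have [xab|] := pselect (span [:: f a; f b; q] (f x)); last first.
  exact: (through_step q0 ta tb).
have [xac|] := pselect (span [:: f a; f c; q] (f x)); last first.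
  exact: (through_step q0 ta tc).
have xa : span [:: f a; q] (f x).
  have H1 : span [:: f b; f a; q] (f x) by span_from xab.
  have H2 : span [:: f c; f a; q] (f x) by span_from xac.
  by apply: (span_meet hK' H1 H2) => H; apply: nabc; span_from H.
apply: (through_step q0 tb tc nbc vxy) => xbc.
have ax := span_exchange hK' xa nx.
have abc : span [:: f c; f b; q] (f a) by span_from ax.
have nba : ~ span [:: f b; q] (f a).
  have [_ na _ _] := ta; move=> H; apply: nab.
  exact: span_exchange H na.
have H := span_exchange hK' abc nba; apply: nabc; span_from H.
Qed.

(** The concurrence argument. A nondegenerate line [f a], [f b] and the line of a
    third point [f c] off it are coplanar, and meet in [q]; a fourth point off
    their plane gives the third independent line. *)
Lemma image_at_outside : exists q, image_at v q.
Proof.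
(* Degenerate case: no line through [v] has a line as image. *)
have [deg|] := pselect (forall x y, span [:: e x; e y] v -> span [:: f x] (f y)).
  exists 0 => x y vxy _; split; first exact: span0.
  by move=> _; have H := deg _ _ vxy; span_from H.
move=> /existsNP[a /existsNP[b /not_implyP[vab nab]]].
have [c nc] := f_rank (f a) (f b) 0.
have {}nc : ~ span [:: f a; f b] (f c) by move=> H; apply: nc; span_from H.
have [d [vcd _]] := e_line v c.
have [g qab] : span [:: f c; f a; f b] (f d).
  by have H := ef_coplanar vab vcd; span_from H.
pose q := f d - g *: f c; rewrite -[_ - _]/q -[X in X q]/(span [:: f a; f b]) in qab.
have dq : span [:: f c; q] (f d).
  by exists g; rewrite -/q; apply: span_mem; rewrite mem_head.
have qcd : span [:: f c; f d] q.
  by apply: spanB; [|apply: spanZ]; apply: span_mem; rewrite !inE eqxx ?orbT.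
have q0 : q != 0.
  apply/eqP => q0; rewrite q0 in dq; have dc : span [:: f c] (f d) by span_from dq.
  have bac : span [:: f c; f a] (f b) by have H := ef_coplanar vcd vab; span_from H.
  by apply: nc; have H := span_exchange hK' bac nab; span_from H.
have ncq : ~ span [:: q] (f c) by move=> H; apply: nc; span_from H.
have tc : through q c d by split.
(* The point [q] may be the image of [a], in which case [b] takes its place. *)
have [a1 [b1 [ta na1c]]] : exists x y, through q x y /\ ~ span [:: f x; q] (f c).
  have [aq|naq] := pselect (span [:: q] (f a)); last first.
    exists a, b; split; last by move=> H; apply: nc; span_from H.
    split=> //; have qba : span [:: f b; f a] q by span_from qab.
    have nqa : ~ span [:: f a] q by move=> H; apply: naq; exact: span1_sym.
    have H := span_exchange hK' qba nqa; by span_from H.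
  exists b, a; split; last by move=> H; apply: nc; span_from H.
  split; [by span_from vab| |by span_from qab|by span_from aq].
  move=> H; apply: nab; have qa := span1_sym hK' aq (f_neq0 a).
  by span_from H.
have [x nx] := f_rank (f a1) (f c) q; have [y [vxy _]] := e_line v x.
have tx := through_step q0 ta tc na1c vxy nx.
have all := through_all q0 ta tc tx na1c nx.
exists q => z t vzt _; split; last by move=> /(all _ _ vzt)[].
have [H|/(all _ _ vzt)[//]] := pselect (span [:: q] (f z)).
have H' := span1_sym hK' H (f_neq0 z); by span_from H'.
Qed.

End OutsidePoint.

Lemma image_at_ex v : exists q, image_at v q.
Proof.
have [[x xv]|/forallNP nv] := pselect (exists x, span [:: e x] v); last first.
  exact: image_at_outside.
have [->|v0] := eqVneq v 0.
  exists 0 => y z _ yz; split=> [|_]; first exact: span0.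
  have {}yz : span [:: e y; e y] (e z) by span_from yz.
  have H := ef_span2 yz; by span_from H.
have vx := span1_sym hK xv v0.
exists (f x) => y z vyz zyv; split=> [|_].
  by apply: ef_span2; span_from vx.
by apply: ef_span2; span_from zyv.
Qed.

(** Seen from a point of [X] whose image is general, the three points become
    points of [X], where [ef_span] applies. *)
Lemma image_at_span u v w p q r : span [:: u; v] w ->
  image_at u p -> image_at v q -> image_at w r -> span [:: p; q] r.
Proof.
move=> wuv up vq wr; have [a na] := f_rank p q r.
have nap : ~ span [:: p] (f a) by move=> H; apply: na; span_from H.
have naq : ~ span [:: q] (f a) by move=> H; apply: na; span_from H.
have nar : ~ span [:: r] (f a) by move=> H; apply: na; span_from H.
have [b [uab bau]] := e_line u a.
have [c [vac cav]] := e_line v a.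
have [d [wad daw]] := e_line w a.
have [_ /(_ nap) pb] := up _ _ uab bau.
have [_ /(_ naq) qc] := vq _ _ vac cav.
have [rd _] := wr _ _ wad daw.
have dabc : span [:: e a; e b; e c] (e d).
  have w' : span [:: e a; e b; e c] w by span_from wuv.
  by span_from daw.
have fd : span [:: f a; p; q] (f d) by have H := ef_span dabc; span_from H.
have ra : span [:: f a; p; q] r by span_from rd.
apply: contrapT => nr; apply: na.
have H := span_exchange hK' ra nr; by span_from H.
Qed.

(** A semilinear map inducing [f] on [X] is determined up to scale, point by
    point: its value at [v] is a possible image of [v]. *)
Lemma semilinear_image_at (Phi : V -> V') : Defs.semilinear Phi ->
    (forall x, span [:: f x] (Phi (e x))) -> (forall x, span [:: Phi (e x)] (f x)) ->
  forall v, image_at v (Phi v).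
Proof.
move=> [PhiD [s PhiZ]] Pf fP v x y; move=> /span2P[a [b vE]] /span2P[c [d yE]].
have Px := Pf x; have Py := Pf y; have fx := fP x; have fy := fP y.
split=> [|_].
  have H : span [:: Phi (e x); Phi (e y)] (Phi v).
    by rewrite vE PhiD !PhiZ; apply/span2P; exists (s a), (s b).
  by span_from H.
have H : span [:: Phi (e x); Phi v] (Phi (e y)).
  by rewrite yE PhiD !PhiZ; apply/span2P; exists (s c), (s d).
have H' : span [:: f x; Phi v] (Phi (e y)) by span_from H.
by span_from fy.
Qed.

Theorem semilinear_extension : exists Phi : V -> V', Defs.semilinear Phi /\
  forall x, span [:: f x] (Phi (e x)) /\ span [:: Phi (e x)] (f x).
Proof.
have [q qP] := choice image_at_ex.
have q_span u v w : span [:: u; v] w -> span [:: q u; q v] (q w).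
  by move=> wuv; apply: image_at_span wuv _ _ _.
have fq x : span [:: f x] (q (e x)) /\ span [:: q (e x)] (f x).
  have xx : span [:: e x; e x] (e x) by apply: span_head.
  have H := image_at_span xx (@image_at_point x) (@image_at_point x) (qP (e x)).
  have H' := image_at_span xx (qP (e x)) (qP (e x)) (@image_at_point x).
  by split; [span_from H|span_from H'].
have [x y|Phi [sPhi PhiP]] := fundamental_theorem hK' q_span.
  have [z nz] := f_rank x y 0; exists (e z) => H; apply: nz.
  have [_ H'] := fq z; by span_from H'.
exists Phi; split=> // x; have [qx xq] := fq x; have [Pq qP'] := PhiP (e x).
by split; [span_from Pq|span_from xq].
Qed.

End Extension.

(** * Points of a projectivized space and their vectors *)

Section Points.
Variables (K : unitRingType) (V : lmodType K).
Implicit Types (p : PV V) (v w : V) (s : seq V).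

Lemma vlineP v w : vline v w <-> span [:: v] w.
Proof. by split=> /span1P. Qed.

Definition rep p : V := sval (cid (proj2_sig p)).

Lemma rep_neq0 p : rep p != 0.
Proof. by rewrite /rep; case: cid => v []. Qed.

Lemma rep_vline p : sval p = vline (rep p).
Proof. by rewrite /rep; case: cid => v []. Qed.

Lemma point_eq p p' : sval p = sval p' -> p = p'.
Proof. case: p p' => [L hL] [L' hL'] /= LL'; exact: eq_exist. Qed.

Lemma pt_of_rep p : pt_of (rep_neq0 p) = p.
Proof. by apply: point_eq; rewrite /= rep_vline. Qed.

Lemma pt_of_span v w (v0 : v != 0) (w0 : w != 0) :
  pt_of v0 = pt_of w0 -> span [:: w] v.
Proof.
move=> /(congr1 sval) /= vw; apply/vlineP; rewrite -vw.
by apply/vlineP; apply: span_head.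
Qed.

Lemma pt_of_eq v w (v0 : v != 0) (w0 : w != 0) : division_ring K ->
  span [:: w] v -> pt_of v0 = pt_of w0.
Proof.
move=> hK wv; have vw := span1_sym hK wv v0; apply: point_eq => /=.
by apply/seteqP; split=> u /vlineP uu; apply/vlineP; span_from uu.
Qed.

Lemma rep_pt_of v (v0 : v != 0) :
  span [:: v] (rep (pt_of v0)) /\ span [:: rep (pt_of v0)] v.
Proof.
by have vE := pt_of_rep (pt_of v0); split; [have := vE|have := esym vE] => /pt_of_span.
Qed.

Lemma span_subspace s : subspace (PV V) [set p | span s (rep p)].
Proof.
exists (fun u => `[< span s u >]); split.
  split=> [|a u v /asboolP su /asboolP sv]; apply/asboolP; first exact: span0.
  by apply: spanD => //; apply: spanZ.
apply/seteqP; split=> p /=.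
  move=> sp u; rewrite rep_vline => /vlineP pu; apply/asboolP.
  by span_from pu.
move/(_ (rep p)); rewrite rep_vline => /(_ _)/asboolP; apply.
by apply/vlineP; apply: span_head.
Qed.

(** Membership in a subspace of [PV V] can be tested on the chosen representatives. *)
Lemma subspace_span T s p : subspace (PV V) T ->
  (forall v, v \in s -> exists2 p', T p' & rep p' = v) -> span s (rep p) -> T p.
Proof.
move=> [W [[W0 WD] ->]] sT sp u; rewrite rep_vline => /vlineP pu.
have su : span s u by span_from pu.
move: u su {pu}; apply: span_min => //.
- by move=> u v Wu Wv; rewrite -[u]scale1r; apply: WD.
- by move=> a u Wu; rewrite -[_ *: _]addr0; apply: WD.
by move=> v /sT[p' Tp' <-]; apply: Tp'; rewrite rep_vline; apply/vlineP/span_head.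
Qed.

End Points.

(** * Minimal projective embeddings in coordinates *)

Section MinimalEmbedding.
Variables (K : unitRingType) (V : lmodType K) (hK : division_ring K).
Variables (X : pregeometry) (j : X -> PV V) (hj : minimal_projective_embedding j).

Let e (x : X) : V := rep (j x).

Lemma embedding_subspace (S : set X) : subspace X S ->
  exists2 T, subspace (PV V) T & S = j @^-1` T.
Proof.
have [_ [_ [_ [g [cg _ mg]]]] _] := hj.
move=> /mg[T [sT gT]]; exists T => //; apply/seteqP; split=> x Sx.
  have : (g @^-1` S) (corestriction j x) by rewrite /preimage /= cg.
  by rewrite gT.
by have : (g @^-1` S) (corestriction j x); [rewrite gT|rewrite /preimage /= cg].
Qed.

Lemma trace_subspace s : subspace X [set x | span s (e x)].
Proof. have [_ [mj _] _] := hj; exact: mj (span_subspace s). Qed.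

Lemma subspace_trace (S : set X) s x : subspace X S ->
  (forall v, v \in s -> exists2 y, S y & e y = v) -> span s (e x) -> S x.
Proof.
move=> /embedding_subspace[T sT ->] sS; apply: subspace_span => // v /sS[y Ty ye].
by exists (j y).
Qed.

Lemma join_subspace (P : pregeometry) (A B S : set P) :
  subspace P S -> A `<=` S -> B `<=` S -> join A B `<=` S.
Proof. by move=> sS AS BS x; apply; split=> // y [/AS|/BS]. Qed.

Lemma joinl (P : pregeometry) (A B : set P) : A `<=` join A B.
Proof. by move=> x Ax S [_]; apply; left. Qed.

(** A line of the projective space through [j x] is a class of the quotient at that
    point, which contains a point of [X] since the quotients of [X] and of [PV V]
    correspond. *)
Lemma embedding_line v x : exists y, span [:: e x; e y] v /\ span [:: e x; v] (e y).
Proof.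
have [xv|nxv] := pselect (span [:: e x] v).
  by exists x; split; [span_from xv|apply: span_head].
have v0 : v != 0 by apply/eqP => v0; apply: nxv; rewrite v0; apply: span0.
have px : ~ [set j x] (pt_of v0).
  by rewrite /= -[j x]pt_of_rep => /pt_of_span.
have [_ _ /(_ x)[f [[_ [g [_ gK _]]] fE]]] := hj.
pose C : quotient [set j x] :=
  exist _ (quot_class [set j x] (pt_of v0)) (ex_intro _ _ (conj px erefl)).
have [y [nyx Cy]] := proj2_sig (g C).
have := fE (g C) y; rewrite Cy gK => /(_ (conj nyx erefl)) [njyx jE].
have [vr rv] := rep_pt_of v0.
exists y; split.
  suff H : span [:: e x; e y] (rep (pt_of v0)) by span_from rv.
  have : join [set j y] [set j x] (pt_of v0) by rewrite -jE; apply: joinl.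
  apply: (join_subspace (span_subspace [:: e x; e y])) => _ ->;
    by apply: span_mem; rewrite !inE eqxx ?orbT.
suff H : span [:: e x; rep (pt_of v0)] (e y) by span_from H.
have : @join (PV V) [set pt_of v0] [set j x] (j y) by rewrite jE; apply: joinl.
apply: (join_subspace (span_subspace [:: e x; rep (pt_of v0)])) => _ ->;
  by apply: span_mem; rewrite !inE eqxx ?orbT.
Qed.

Lemma card_three T (A : set T) : `I_3 #<= A ->
  exists a b c, [/\ A a, A b & A c] /\ [/\ a <> b, a <> c & b <> c].
Proof.
move=> /card_leP[g].
have lt i : (i < 3)%N -> i \in `I_3 by move=> ?; exact: mem_set.
pose h i (i3 : (i < 3)%N) := val (g (SigSub (lt i i3))).
have hA i i3 : A (@h i i3) by apply: set_mem; exact: valP.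
have hinj i k i3 k3 : @h i i3 = @h k k3 -> i = k.
  by move=> /val_inj/inj => /(_ (mem_set I) (mem_set I))/(congr1 val).
exists (@h 0%N isT), (@h 1%N isT), (@h 2%N isT).
by split; split=> // /hinj.
Qed.

Lemma independent_not_span (A : set X) a b c : independent A ->
  A b -> A c -> A a -> a <> b -> a <> c -> ~ span [:: rep (j b); rep (j c)] (rep (j a)).
Proof.
move=> iA Ab Ac Aa ab ac H; apply: (iA a Aa) => S [sS AS].
apply: (subspace_trace sS) H => v; rewrite !inE => /orP[]/eqP ->.
  by exists b => //; apply: AS; split=> // ba; apply: ab.
by exists c => //; apply: AS; split=> // ca; apply: ac.
Qed.

Lemma three_points : admissible X -> exists (A : set X), independent A /\ `I_3 #<= A.
Proof.
move=> [_ _ [[_ [A [[iA _ _] cA]]]|[[_ [A [[iA _ _] cA]]] _]]]; exists A; split=> //.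
  by apply: card_le_trans cA; rewrite card_le_II.
have /andP[_ cA'] : (A #<= `I_4) && (`I_4 #<= A) by rewrite -card_eq_le.
by apply: card_le_trans cA'; rewrite card_le_II.
Qed.

Lemma admissible_rank : admissible X ->
  forall s : seq V, (size s <= 2)%N -> exists y, ~ span s (rep (j y)).
Proof.
move=> /three_points[A [iA /card_three[a [b [c [[Aa Ab Ac] [ab ac bc]]]]]]] s s2.
apply: contrapT => /forallNP sA.
have {}sA y : span s (rep (j y)) by apply: contrapT; exact: sA.
suff : (3 <= 2)%N by [].
apply: leq_trans s2.
apply: (steinitz hK (s := [:: rep (j a); rep (j b); rep (j c)])).
  split; first exact: (independent_not_span iA).
  split; last by split=> //; apply/eqP; exact: rep_neq0.
  move=> H; apply: (independent_not_span iA Ac Ac Ab bc bc).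
  by span_from H.
by move=> v; rewrite !inE => /or3P[]/eqP ->.
Qed.

(** A subspace of [X] is the trace of a subspace of [PV V], so linearly independent
    points form a basis of the trace of their span. *)
Lemma span_plane a b c : let s := [:: rep (j a); rep (j b); rep (j c)] in
  free s -> plane [set x | span s (rep (j x))].
Proof.
move=> s fs; split; first exact: trace_subspace.
pose g i := nth a [:: a; b; c] i.
have [nabc [nbc [nc _]]] := fs.
exists (g @` `I_3); split; last first.
  apply: inj_card_eq => i k /set_mem /= i3 /set_mem /= k3.
  have nab : a <> b by move=> ab; apply: nabc; rewrite ab; apply: span_head.
  have nac : a <> c.
    by move=> ac; apply: nabc; rewrite ac; apply: span_mem; rewrite !inE eqxx orbT.
  have nbc' : b <> c by move=> bc; apply: nbc; rewrite bc; apply: span_head.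
  case: i i3 => [|[|[|i]]] // _; case: k k3 => [|[|[|k]]] // _ gE; exfalso;
    by [apply: nab|apply: nac|apply: nbc'|apply: nab|apply: nac|apply: nbc'].
have gs x : (g @` `I_3) x -> span s (rep (j x)).
  move=> [i i3 <-]; apply: span_mem.
  by case: i i3 => [|[|[|i]]] // _; rewrite !inE eqxx ?orbT.
split=> //.
- have gind i : (i < 3)%N -> exists t, ~ span t (rep (j (g i))) /\
      forall k, (k < 3)%N -> k != i -> span t (rep (j (g k))).
    have nb : ~ span [:: rep (j a); rep (j c)] (rep (j b)).
      move=> H; apply: nabc; have := span_exchange hK H => /(_ _); apply.
      by move=> H'; apply: nbc; span_from H'.
    have nc' : ~ span [:: rep (j a); rep (j b)] (rep (j c)).
      move=> H; have nbc' : ~ span [:: rep (j b)] (rep (j c)).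
        move=> H'; apply: nbc; apply: span1_sym H' _ => //; exact: rep_neq0.
      by apply: nabc; have H' := span_exchange hK H nbc'; span_from H'.
    case: i => [|[|[|i]]] // _.
    + exists [:: rep (j b); rep (j c)]; split=> // -[|[|[|k]]] // _ _;
        by apply: span_mem; rewrite !inE eqxx ?orbT.
    + exists [:: rep (j a); rep (j c)]; split=> // -[|[|[|k]]] // _ _;
        by apply: span_mem; rewrite !inE eqxx ?orbT.
    + exists [:: rep (j a); rep (j b)]; split=> // -[|[|[|k]]] // _ _;
        by apply: span_mem; rewrite !inE eqxx ?orbT.
  move=> _ [i i3 <-] cl; have [t [nt tg]] := gind i i3; apply: nt.
  apply: (cl [set x | span t (rep (j x))]); split; first exact: trace_subspace.
  move=> _ [[k k3 <-] kn]; apply: tg => //; by apply/eqP => ki; apply: kn; rewrite ki.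
apply/seteqP; split=> x.
  by apply; split=> //; exact: trace_subspace.
move=> sx S [sS gS]; apply: (subspace_trace sS) sx => v.
rewrite !inE => /or3P[]/eqP ->; [exists a|exists b|exists c] => //; apply: gS.
- by exists 0%N.
- by exists 1%N.
- by exists 2%N.
Qed.

End MinimalEmbedding.

(** * Morphisms and the partial maps that extend them *)

Section Morphism.
Variables (K K' : unitRingType) (V : lmodType K) (V' : lmodType K').
Hypotheses (hK : division_ring K) (hK' : division_ring K').
Variables (X X' : pregeometry) (j : X -> PV V) (j' : X' -> PV V').
Hypotheses (hj : minimal_projective_embedding j).
Hypotheses (hj' : minimal_projective_embedding j').
Variable (phi : X -> X').

Lemma morphism_span (x y1 y2 y3 : X) : morphism phi ->
  span [:: rep (j y1); rep (j y2); rep (j y3)] (rep (j x)) ->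
  span [:: rep (j' (phi y1)); rep (j' (phi y2)); rep (j' (phi y3))] (rep (j' (phi x))).
Proof.
move=> mphi.
set s := [:: rep (j' (phi y1)); _; _].
have sS := mphi _ (trace_subspace hj' s).
apply: (subspace_trace hj sS) => v; rewrite !inE => /or3P[]/eqP ->.
- by exists y1 => //; apply: span_mem; rewrite !inE eqxx ?orbT.
- by exists y2 => //; apply: span_mem; rewrite !inE eqxx ?orbT.
- by exists y3 => //; apply: span_mem; rewrite !inE eqxx ?orbT.
Qed.

(** Three points of [X'] are chosen one after the other in general position,
    in the image of [phi] as long as that is possible; if the image had rank at
    most 3, they would span a plane containing it. *)
Lemma morphism_rank : admissible X' -> ~ coplanar (range phi) ->
  forall p q r, exists x, ~ span [:: p; q; r] (rep (j' (phi x))).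
Proof.
move=> hX' ncop p q r; apply: contrapT => /forallNP pqr.
have {}pqr x : span [:: p; q; r] (rep (j' (phi x))) by apply: contrapT; exact: pqr.
have pick s : (size s <= 2)%N -> exists y, ~ span s (rep (j' y)) /\
    ((exists x, ~ span s (rep (j' (phi x)))) -> exists x, y = phi x).
  move=> s2; have [[x nx]|nx] := pselect (exists x, ~ span s (rep (j' (phi x)))).
    by exists (phi x); split=> // _; exists x.
  by have [y ny] := admissible_rank hK' hj' hX' s2; exists y.
have [c [nc cphi]] := pick [::] isT.
have [b [nb bphi]] := pick [:: rep (j' c)] isT.
have [a [na aphi]] := pick [:: rep (j' b); rep (j' c)] isT.
have abc : free [:: rep (j' a); rep (j' b); rep (j' c)] by [].
apply: ncop; exists [set y | span [:: rep (j' a); rep (j' b); rep (j' c)] (rep (j' y))].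
split; first exact: span_plane.
move=> _ [x _ <-].
suff : span [:: rep (j' a); rep (j' b); rep (j' c)] (rep (j' (phi x))) by [].
apply: contrapT => nx.
have [xa aE] : exists x, a = phi x.
  by apply: aphi; exists x => H; apply: nx; span_from H.
have [xb bE] : exists x, b = phi x.
  by apply: bphi; exists x => H; apply: nx; span_from H.
have [xc cE] : exists x, c = phi x.
  apply: cphi; exists x; apply/eqP; exact: rep_neq0.
suff : (4 <= 3)%N by [].
apply: (steinitz hK' (s := [:: rep (j' (phi x)); rep (j' a); rep (j' b); rep (j' c)])
   (t := [:: p; q; r])) => //.
by move=> v; rewrite !inE => /or4P[]/eqP ->; rewrite ?aE ?bE ?cE.
Qed.

Definition induces (Phi : V -> V') (g : PV V -> option (PV V')) : Prop :=
  forall (v : V) (v0 : v != 0),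
    (Phi v = 0 -> g (pt_of v0) = None) /\
    (forall w0 : Phi v != 0, g (pt_of v0) = Some (pt_of w0)).

Definition proj_map (Phi : V -> V') (p : PV V) : option (PV V') :=
  if pselect (Phi (rep p) != 0) is left w0 then Some (pt_of w0) else None.

Lemma span_line0 (x : V') : span [:: 0] x -> x = 0.
Proof. by move=> /span1P[a ->]; rewrite scaler0. Qed.

Lemma proj_map_induces (Phi : V -> V') :
  Defs.semilinear Phi -> induces Phi (proj_map Phi).
Proof.
move=> [_ [t tP]] v v0; have [vr rv] := rep_pt_of v0.
have PhiS u w : span [:: u] w -> span [:: Phi u] (Phi w).
  by move=> /span1P[a ->]; rewrite tP; apply: span_scale.
have Pvr := PhiS _ _ vr; have Prv := PhiS _ _ rv; rewrite /proj_map.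
split=> [v00|w0]; case: pselect => r0 //.
- by case/eqP: r0; apply: span_line0; rewrite -v00.
- by congr Some; apply: pt_of_eq.
case/eqP: w0; apply: span_line0; move/negP/negPn/eqP: r0 => <-.
exact: Prv.
Qed.

(** Proportional maps vanish at the same vectors and induce the same points. *)
Lemma induces_eq (Phi Psi : V -> V') g h : induces Phi g -> induces Psi h ->
    (forall v, span [:: Phi v] (Psi v)) -> (forall v, span [:: Psi v] (Phi v)) ->
  g = h.
Proof.
move=> gP hP PhiPsi PsiPhi; apply: funext => p; rewrite -(pt_of_rep p).
have [g0 g1] := gP _ (rep_neq0 p); have [h0 h1] := hP _ (rep_neq0 p).
have := PhiPsi (rep p); have := PsiPhi (rep p).
have [Phi0|w0] := eqVneq (Phi (rep p)) 0.
  by rewrite Phi0 => _ /span_line0 Psi0; rewrite g0 // h0.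
have [Psi0|w0'] := eqVneq (Psi (rep p)) 0.
  by rewrite Psi0 => /span_line0 Phi0; rewrite Phi0 eqxx in w0.
by move=> PP _; rewrite (g1 w0) (h1 w0'); congr Some; apply: pt_of_eq.
Qed.

Lemma induces_at (Phi : V -> V') g p p' : induces Phi g -> g p = Some p' ->
  span [:: rep p'] (Phi (rep p)) /\ span [:: Phi (rep p)] (rep p').
Proof.
move=> gP gp; have [g0 g1] := gP _ (rep_neq0 p); rewrite pt_of_rep gp in g0 g1.
have [/g0 //|w0] := eqVneq (Phi (rep p)) 0.
have H : pt_of (rep_neq0 p') = pt_of w0 by rewrite pt_of_rep; exact/Some_inj/g1.
by split; [apply: pt_of_span (esym H)|apply: pt_of_span H].
Qed.

Lemma proj_map_at (Phi : V -> V') p p' :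
  span [:: rep p'] (Phi (rep p)) -> span [:: Phi (rep p)] (rep p') ->
  proj_map Phi p = Some p'.
Proof.
move=> pP Pp; rewrite /proj_map; case: pselect => [w0|/negP/negPn/eqP z].
  by congr Some; rewrite -[RHS]pt_of_rep; exact: pt_of_eq.
by move: Pp; rewrite z => /span_line0/eqP; rewrite (negPf (rep_neq0 p')).
Qed.

End Morphism.

Theorem theorem3p11 (K K' : unitRingType) (V : lmodType K) (V' : lmodType K')
    (hK : division_ring K) (hK' : division_ring K')
    (X X' : pregeometry) (hX : admissible X) (hX' : admissible X')
    (j : X -> PV V) (j' : X' -> PV V')
    (hj : minimal_projective_embedding j)
    (hj' : minimal_projective_embedding j')
    (phi : X -> X') (hphi : morphism phi)
    (hplane : ~ coplanar (range phi)) :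
  exists! g : PV V -> option (PV V'),
    partial_projective_morphism g /\
    forall x : X, g (j x) = Some (j' (phi x)).
Proof.
pose e x := rep (j x); pose f x := rep (j' (phi x)).
have e_line v x : exists y, span [:: e x; e y] v /\ span [:: e x; v] (e y).
  exact: (embedding_line hj).
have ef_span x y1 y2 y3 : span [:: e y1; e y2; e y3] (e x) ->
    span [:: f y1; f y2; f y3] (f x) by exact: (morphism_span hj hj' hphi).
have f_rank p q r : exists x, ~ span [:: p; q; r] (f x).
  exact: (morphism_rank hK' hj' hX' hplane).
have f_neq0 x : f x != 0 by exact: rep_neq0.
have [Phi [sPhi Phif]] := semilinear_extension hK hK' e_line ef_span f_neq0 f_rank.
exists (proj_map Phi); split.
  split; first by exists Phi => //; exact: (proj_map_induces hK' sPhi).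
  by move=> x; have [? ?] := Phif x; exact: proj_map_at.
move=> g [[Psi sPsi PsiP] gx].
have Psif x : span [:: f x] (Psi (e x)) /\ span [:: Psi (e x)] (f x).
  exact: induces_at PsiP (gx x).
have Phi_im v : image_at e f v (Phi v).
  by apply: semilinear_image_at => // x; have [] := Phif x.
have Psi_im v : image_at e f v (Psi v).
  by apply: semilinear_image_at => // x; have [] := Psif x.
have uniq_im v y z : image_at e f v y -> image_at e f v z -> span [:: y] z.
  move=> vy vz; have vv : span [:: v; v] v by apply: span_head.
  by have H := image_at_span hK' e_line ef_span f_rank vv vy vy vz; span_from H.
apply: (induces_eq hK' (proj_map_induces hK' sPhi) PsiP) => // v.
  exact: uniq_im (Phi_im v) (Psi_im v).
exact: uniq_im (Psi_im v) (Phi_im v).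
Qed.
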